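(* There is a universal constant $c>0$ such that the following holds. For every integer $M\ge6$, every $L>0$, $R>0$, and every integer $S\ge1$, on the $M$-node path graph (with gossip spectral gap $\rho=\frac12(1-\cos\frac{\pi}{M})=\Theta(M^{-2})$) there exist convex $L$-smooth functions $f_1,\dots,f_M:\mathbb R^d\to\mathbb R$, in dimension $d=\Theta(1+S\sqrt\rho)$ (with universal constants), such that for $f(x)=\frac1M\sum_{i=1}^M f_i(x)$ the minimizer $x^\star$ of $f$ satisfies $\|x^\star\|\le R$, and every deterministic linear-span decentralized first-order method (as defined in the context) run for $S$ gossip communication rounds has averaged output $\bar x_S$ satisfying $$f(\bar x_S)-f(x^\star)\ge cLR^2\min\left\{1,\frac{1}{\rho S^2}\right\}.$$
   Context: The path graph has vertices $\{1,\dots,M\}$ and edges $E=\{\{i,i+1\}:1\le i<M\}$. Its gossip matrix is $P_{\rm path}=I-\frac14\mathsf L_{\rm path}$, where $\mathsf L_{\rm path}$ is the unnormalized graph Laplacian of the path; $\rho=1-\lambda_2(P_{\rm path})=\frac12(1-\cos\frac\pi M)$ is its spectral gap. $\|\cdot\|$ is the Euclidean norm, and a function is $L$-smooth if its gradient is $L$-Lipschitz. Linear-span decentralized first-order methods. Worker $i$ has access to (exact) gradients of $f_i$. In each communication round a node may perform arbitrary local linear algebra on the vectors it holds, query its local gradient at points in the span of those vectors, and send arbitrary vectors from this span to its neighbors. Equivalently, letting $\mathcal S_i(t)\subseteq\mathbb R^d$ denote the subspace available to node $i$ after $t$ gossip communication rounds, all nodes are initialized at the origin, $\mathcal S_i(0)=\{0\}$,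 and $\mathcal S_i(t+1)$ is contained in the span of $\mathcal S_i(t)$, the neighboring subspaces $\mathcal S_j(t)$ with $\{i,j\}\in E$, and the local gradients $\nabla f_i(y)$ evaluated at points $y$ in that span. After $S$ rounds each node $i$ has a local output in $\mathcal S_i(S)$, and $\bar x_S$ denotes the average over the $M$ nodes of these local outputs. *)

(* Defs.v *)
From HB Require Import structures.
From mathcomp Require Import all_boot all_order all_algebra.
From mathcomp Require Import all_classical all_reals all_analysis.
Set Implicit Arguments.
Unset Strict Implicit.
Unset Printing Implicit Defensive.
Import Order.TTheory GRing.Theory Num.Theory.
Import numFieldNormedType.Exports.
Local Open Scope ring_scope.

(* Vectors of R^d are row vectors 'rV[R]_d. The library norm `|x| on 'rV[R]_d
   is the sup norm, hence the explicit Euclidean norm. *)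
Definition enorm (R : realType) (d : nat) (x : 'rV[R]_d) : R :=
  Num.sqrt (\sum_(j < d) x 0 j ^+ 2).

Definition grad (R : realType) (d : nat) (f : 'rV[R]_d -> R)
    (x : 'rV[R]_d) : 'rV[R]_d :=
  \row_(j < d) 'D_(delta_mx 0 j) f x.

Definition smooth (R : realType) (d : nat) (L : R) (f : 'rV[R]_d -> R) : Prop :=
  (forall x, differentiable f x) /\
  (forall x y, enorm (grad f x - grad f y) <= L * enorm (x - y)).

Definition is_minimizer (R : realType) (d : nat) (f : 'rV[R]_d -> R)
    (x : 'rV[R]_d) : Prop :=
  forall y, f x <= f y.

Definition average (R : realType) (d M : nat) (f : 'I_M -> 'rV[R]_d -> R)
    (x : 'rV[R]_d) : R :=
  M%:R^-1 * \sum_(i < M) f i x.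

(* Vertices are numbered from 0 to M - 1. *)
Definition path_edge (M : nat) : rel 'I_M :=
  fun i j => (i.+1 == j :> nat) || (j.+1 == i :> nat).

Definition laplacian (R : realType) (M : nat) (e : rel 'I_M) : 'M[R]_M :=
  \matrix_(i, j) (#|[pred k | e i k]|%:R *+ (i == j) - (e i j)%:R).

Definition path_gossip (R : realType) (M : nat) : 'M[R]_M :=
  1%:M - 4^-1 *: laplacian R (@path_edge M).

(* The eigenvalues with multiplicity, in nonincreasing order; [::] if the
   characteristic polynomial does not split over R. *)
Definition eigvals (R : realType) (n : nat) (A : 'M[R]_n) : seq R :=
  xget [::] [set s : seq R | sorted >=%R s /\
                             char_poly A = \prod_(a <- s) ('X - a%:P)]%classic.

Definition spectral_gap (R : realType) (n : nat) (A : 'M[R]_n) : R :=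
  1 - (eigvals A)`_1.

(* All vectors a node can compute locally from the subspace W it holds: any
   number of adaptive queries of its gradient oracle g is allowed between two
   communications. *)
Inductive local_span (R : realType) (d : nat) (g : 'rV[R]_d -> 'rV[R]_d)
    (W : {vspace 'rV[R]_d}) : 'rV[R]_d -> Prop :=
| LocalMem v : v \in W -> local_span g W v
| LocalLin (a : R) u v :
    local_span g W u -> local_span g W v -> local_span g W (a *: u + v)
| LocalGrad y : local_span g W y -> local_span g W (g y).

(* A t i is the subspace available to node i after t rounds and out i is the
   output of node i after S rounds. The executions of deterministic
   linear-span methods on f are exactly the pairs (A, out) satisfying this
   predicate. *)
Definition linear_span_run (R : realType) (d M : nat) (e : rel 'I_M)
    (f : 'I_M -> 'rV[R]_d -> R) (S : nat)
    (A : nat -> 'I_M -> {vspace 'rV[R]_d}) (out : 'I_M -> 'rV[R]_d) : Prop :=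
  [/\ forall i, A 0%N i = 0%VS,
      forall t i v, (t < S)%N -> v \in A t.+1 i ->
        local_span (grad (f i)) (A t i + \sum_(j | e i j) A t j)%VS v
    & forall i, out i \in A S i].

(* Main.v *)
Require Import Defs.
From HB Require Import structures.
From mathcomp Require Import all_boot all_order all_algebra.
From mathcomp Require Import all_classical all_reals all_analysis.
From mathcomp Require Import zify ring lra.
Set Implicit Arguments.
Unset Strict Implicit.
Unset Printing Implicit Defensive.
Import Order.TTheory GRing.Theory Num.Theory.
Import numFieldNormedType.Exports.
Local Open Scope ring_scope.

(* Nesterov's chain (s - x_1)^2 + (x_1 - x_2)^2 + ... + x_d^2 is split over the
   path: the first third of the nodes owns the even links, the last third the odd
   links, and the other nodes hold the zero function.  A gradient at a point
   supported on the first k coordinates reaches the next one only at an owner of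
   link k, and the
   owners of consecutive links are at least M/3 hops apart, so S rounds reveal
   only k = O(1 + S/M) coordinates.  By Cauchy-Schwarz the chain is at least
   s^2/(k+1) on such points, against a minimum s^2/(d+1); take d = 2k + 1 and
   s = r / sqrt d.  Since M sqrt rho is bounded above and below, S/M is
   comparable to S sqrt rho. *)

(** * Spectrum of the path *)

Lemma path_edge_sym (M : nat) : symmetric (@path_edge M).
Proof. by move=> i j; rewrite /path_edge orbC. Qed.

Lemma sum_path_edge (V : nmodType) (M : nat) (i : 'I_M) (F : nat -> V) :
  \sum_(j | path_edge i j) F j =
  (if (i.+1 < M)%N then F i.+1 else 0) + (if (0 < i)%N then F i.-1 else 0).
Proof.
have pick1 (b : bool) n : (b -> n < M)%N ->
    \sum_(j < M | b && (n == j :> nat)) F j = if b then F n else 0.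
  case: b => [/(_ isT) ltnM|_]; last by rewrite big_pred0.
  by rewrite (big_pred1 (Ordinal ltnM)) // => j; rewrite /= -val_eqE /= eq_sym.
rewrite (bigID (fun j : 'I_M => i.+1 == j :> nat)) /=.
congr (_ + _).
  rewrite -pick1 //; apply: eq_bigl => j; rewrite /path_edge.
  by case: eqP => [ij|]; rewrite ?andbF // ij ltn_ord.
rewrite -pick1 => [|_]; last by rewrite (leq_ltn_trans (leq_pred _)).
apply: eq_bigl => j; rewrite /path_edge; lia.
Qed.

Lemma mulmx_laplacian (R : realType) (M : nat) (e : rel 'I_M) (v : 'rV[R]_M) j :
  symmetric e ->
  (v *m laplacian R e) 0 j = \sum_(i | e j i) (v 0 j - v 0 i).
Proof.
move=> sym_e; rewrite mxE sumrB sumr_const /=.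
under eq_bigr do rewrite mxE mulrBr.
rewrite sumrB (bigD1 j) //= eqxx mulr1n big1 ?addr0 => [|i /negPf ->]; last first.
  by rewrite mulr0n mulr0.
rewrite mulr_natr; congr (_ - _); rewrite [RHS]big_mkcond; apply: eq_bigr => i _.
by rewrite sym_e; case: (e j i); rewrite ?mulr1 ?mulr0.
Qed.

(** Cosine samples at half-integers are symmetric about [-1/2], and also about [M - 1/2] thanks to
    [sin (theta * M) = 0]. A missing neighbour can thus be replaced by the end node itself, and both
    ends obey the interior three-term recurrence. *)
Lemma path_gossip_eigen (R : realType) (M : nat) (theta : R) :
  sin (theta * M%:R) = 0 ->
  let v := \row_(j < M) cos (theta * (j%:R + 2^-1)) in
  v *m path_gossip R M = (1 - 2^-1 * (1 - cos theta)) *: v.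
Proof.
move=> sinM0 v; apply/rowP => j.
rewrite /path_gossip mulmxBr mulmx1 -scalemxAr.
transitivity (v 0 j - 4^-1 * (v *m laplacian R (@path_edge M)) 0 j).
  by rewrite mxE; congr (_ + _); rewrite 2!mxE.
rewrite mulmx_laplacian; last exact: path_edge_sym.
pose F n := cos (theta * (j%:R + 2^-1)) - cos (theta * (n%:R + 2^-1)).
rewrite (eq_bigr (fun i : 'I_M => F i)) => [|i _]; last by rewrite !mxE.
rewrite sum_path_edge !mxE.
have -> : (if (j.+1 < M)%N then F j.+1 else 0)
    = cos (theta * (j%:R + 2^-1)) - cos (theta * (j%:R + 2^-1) + theta).
  case: ltnP => jM; first by rewrite /F -natr1; congr (_ - cos _); ring.
  have defM : M%:R = j%:R + 1 :> R by rewrite natr1; congr _%:R; have := ltn_ord j; lia.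
  have -> : theta * (j%:R + 2^-1) = theta * M%:R - theta / 2 by rewrite defM; field.
  rewrite (_ : _ + theta = theta * M%:R + theta / 2); last by field.
  by rewrite cosB cosD sinM0; ring.
have -> : (if (0 < j)%N then F j.-1 else 0)
    = cos (theta * (j%:R + 2^-1)) - cos (theta * (j%:R + 2^-1) - theta).
  case: ltnP => j0.
    rewrite /F (_ : (nat_of_ord j)%:R = j.-1%:R + 1); last by rewrite natr1 prednK.
    by congr (_ - cos _); ring.
  have -> : nat_of_ord j = 0%N by lia.
  rewrite -[X in _ - X]cosN; apply/eqP; rewrite eq_sym subr_eq0; apply/eqP.
  by congr cos; field.
by rewrite cosD cosB; field.
Qed.

(** A product of monic linear factors determines its roots up to order, and sorting fixes the order,
    so the choice made in [eigvals] is forced. *)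
Lemma eigvals_eq (R : realType) (n : nat) (A : 'M[R]_n) (s : seq R) :
  sorted >=%R s -> char_poly A = \prod_(a <- s) ('X - a%:P) -> eigvals A = s.
Proof.
move=> s_sorted charA; apply: xget_unique => // t [t_sorted charA'].
apply: (sorted_eq _ _ t_sorted s_sorted).
- by move=> x y z /= yx xz; apply: le_trans xz yx.
- by move=> x y /=; rewrite andbC; apply: le_anti.
by apply: prod_XsubC_eq; rewrite -charA'.
Qed.

Lemma path_angle_bound (R : realType) (M m : nat) :
  (m < M)%N -> (m%:R * pi / M%:R : R) \in `[0, pi].
Proof.
move=> mM; have M0 : (0 : R) < M%:R by rewrite ltr0n (leq_ltn_trans _ mM).
rewrite in_itv /= divr_ge0 ?mulr_ge0 ?pi_ge0 ?ler0n //=.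
by rewrite ler_pdivrMr // mulrC ler_wpM2l ?pi_ge0 // ler_nat ltnW.
Qed.

(** The angles [m * pi / M] give [M] eigenvalues, strictly decreasing in [m] because cosine
    decreases on [[0, pi]]. Being distinct, they exhaust the roots of the characteristic polynomial,
    which has degree [M]. *)
Lemma eigvals_path_gossip (R : realType) (M : nat) :
  eigvals (path_gossip R M) =
  mkseq (fun m => 1 - 2^-1 * (1 - cos (m%:R * pi / M%:R))) M.
Proof.
set F := fun m => _; have F_sorted : sorted >%R (mkseq F M).
  apply: (@homo_sorted_in _ _ (gtn M) F ltn) => [m n mM nM lt_mn||].
  - have M0 : (0 : R) < M%:R by rewrite ltr0n (leq_ltn_trans _ mM).
    rewrite /F /= ltrD2l ltrN2 ltr_pM2l ?invr_gt0 ?ltr0n // ltrD2l ltrN2.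
    rewrite ltr_cos ?path_angle_bound //.
    by rewrite ltr_pM2r ?invr_gt0 // ltr_pM2r ?pi_gt0 // ltr_nat.
  - by apply/allP => m; rewrite mem_iota.
  exact: iota_ltn_sorted.
have F_uniq : uniq (mkseq F M).
  apply: (sorted_uniq (leT := >%R)) => // [x y z xy xz|x]; last exact: ltxx.
  exact: lt_trans xz xy.
apply: eigvals_eq; first by apply: sub_sorted F_sorted => x y /ltW.
have F_roots : uniq_roots (mkseq F M) by rewrite uniq_rootsE.
rewrite [LHS](all_roots_prod_XsubC _ _ F_roots).
- by rewrite (monicP (char_poly_monic _)) scale1r.
- by rewrite size_char_poly size_mkseq.
- apply/allP => a /mapP[m]; rewrite mem_iota => /andP[_ mM] ->.
  rewrite -eigenvalue_root_char; apply/eigenvalueP.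
  have M0 : (0 : R) < M%:R by rewrite ltr0n (leq_ltn_trans _ mM).
  exists (\row_(j < M) cos (m%:R * pi / M%:R * (j%:R + 2^-1))).
    apply: path_gossip_eigen; rewrite divfK ?gt_eqF //.
    by elim: (m) => [|n IHn]; rewrite ?mul0r ?sin0 // -natr1 mulrDl mul1r sinDpi IHn oppr0.
  (* The eigenvector is nonzero: its entry 0 is the cosine of half the angle, and that half is below
     [pi / 2]. *)
  have M_gt0 : (0 < M)%N by apply: leq_ltn_trans mM.
  apply/negP => /eqP/rowP/(_ (Ordinal M_gt0)); rewrite !mxE add0r.
  apply/eqP; rewrite gt_eqF // cos_gt0_pihalf //.
  have /[!in_itv]/andP[ge0 _] := path_angle_bound R mM.
  apply/andP; split.
    apply: (@lt_le_trans _ _ 0); last by rewrite divr_ge0.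
    by rewrite oppr_lt0 divr_gt0 ?pi_gt0.
  rewrite ltr_pM2r ?invr_gt0 ?ltr0n // ltr_pdivrMr // mulrC ltr_pM2l ?pi_gt0 //.
  by rewrite ltr_nat.
Qed.

Lemma spectral_gap_path (R : realType) (M : nat) : (1 < M)%N ->
  spectral_gap (path_gossip R M) = 2^-1 * (1 - cos (pi / M%:R)).
Proof.
by move=> M1; rewrite /spectral_gap eigvals_path_gossip nth_mkseq // mul1r; ring.
Qed.

(** The middle term is [sin (x / 2) ^+ 2], and the mean value theorem gives [sin y = cos z * y] with
    [z] so small that [1/2 <= cos z <= 1]. *)
Lemma half_versine_bounds (R : realType) (x : R) : 0 < x -> x <= pi / 3 ->
  x ^+ 2 / 16 <= 2^-1 * (1 - cos x) <= x ^+ 2 / 4.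
Proof.
move=> x0 xpi; set y := x / 2; have y0 : 0 < y by rewrite divr_gt0.
have -> : 2^-1 * (1 - cos x) = sin y ^+ 2.
  have -> : x = y *+ 2 by rewrite mulr2n /y; field.
  by rewrite cos_mulr2n sin2cos2 -mulr_natr; field.
have [|z] := @MVT R sin cos 0 y y0 (fun z _ => is_derive_sin z).
  by apply: continuous_subspaceT; apply: continuous_sin.
rewrite in_itv /= sin0 !subr0 => /andP[z0 zy] ->.
(* Since [2 * z <= pi / 2], the double-angle formula gives [2 * cos z ^+ 2 >= 1], which is more than
   the claim. *)
have cosz : 2^-1 <= cos z.
  have cos2z : 0 <= cos (z *+ 2).
    rewrite cos_ge0_pihalf //; move: zy xpi; rewrite /y; have := pi_gt0 R; lra.
  have cosz0 : 0 <= cos z.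
    rewrite cos_ge0_pihalf //; move: zy xpi; rewrite /y; have := pi_gt0 R; lra.
  move: cos2z; rewrite cos_mulr2n -mulr_natr; set c := cos z => cos2z.
  by rewrite -(ler_pXn2r (ltn0Sn 1)) ?nnegrE ?invr_ge0 ?ler0n //; lra.
have -> : (cos z * y) ^+ 2 = cos z ^+ 2 * (x ^+ 2 / 4) by rewrite /y; field.
have c_le : cos z ^+ 2 <= 1 by rewrite expr_le1 ?cos_le1 // (le_trans _ cosz).
have c_ge : 4^-1 <= cos z ^+ 2 by nra.
have x2 : 0 <= x ^+ 2 by exact: sqr_ge0.
nra.
Qed.

(** * The split chain *)

(* Boundary values [s] at 0 and 0 beyond [d]; the vector fills positions 1 to d. *)
Definition chain_coord (R : realType) (d : nat) (s : R) (x : 'rV[R]_d) (n : nat) : R :=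
  if n is m.+1 then (if insub m is Some i then x 0 i else 0) else s.

Definition link (R : realType) (d : nat) (s : R) (x : 'rV[R]_d) (j : nat) : R :=
  chain_coord s x j - chain_coord s x j.+1.

(** Multiples of owner indicators as weights give the local functions, and constant weights give
    their average. *)
Definition chain (R : realType) (d : nat) (w : nat -> R) (s : R) (x : 'rV[R]_d) : R :=
  \sum_(j < d.+1) w j * link s x j ^+ 2.

Section Chain.
Variables (R : realType) (d : nat).
Implicit Types (w : nat -> R) (s t a b : R) (x y v : 'rV[R]_d).

Lemma chain_coordS s x (i : 'I_d) : chain_coord s x i.+1 = x 0 i.
Proof. by rewrite /chain_coord valK. Qed.

Lemma chain_coord_out s x n : (d < n)%N -> chain_coord s x n = 0.
Proof. by case: n => // m; rewrite ltnS => dm; rewrite /= insubF // ltnNge dm. Qed.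

Lemma chain_coordP s x n : (0 < n)%N ->
  (forall i : 'I_d, i.+1 = n -> x 0 i = 0) -> chain_coord s x n = 0.
Proof.
case: n => // n _ x0; rewrite /chain_coord; case: insubP => // i _ def_n.
by rewrite x0 // def_n.
Qed.

(** Coordinates are only affine in [x], but linear in [s] and [x] jointly; in particular a
    difference of two points has boundary value 0. *)
Lemma chain_coord_lin a b s t x y n :
  chain_coord (a * s + b * t) (a *: x + b *: y) n =
  a * chain_coord s x n + b * chain_coord t y n.
Proof.
by case: n => //= n; case: insub => [i|]; rewrite ?mxE // !mulr0 addr0.
Qed.

Lemma link_lin a b s t x y n :
  link (a * s + b * t) (a *: x + b *: y) n = a * link s x n + b * link t y n.
Proof. by rewrite /link !chain_coord_lin; ring. Qed.

Lemma linkB s t x y n : link (s - t) (x - y) n = link s x n - link t y n.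
Proof.
by have := link_lin 1 (-1) s t x y n; rewrite !mul1r scale1r !mulN1r scaleN1r.
Qed.

Lemma sum_link s x n : \sum_(0 <= j < n) link s x j = s - chain_coord s x n.
Proof.
by rewrite -[LHS]opprK -sumrN; under eq_bigr do rewrite opprB;
  rewrite telescope_sumr // opprB.
Qed.

Lemma convex_chain w s : (forall j, 0 <= w j) ->
  convex_function [set: 'rV[R]_d] (chain w s).
Proof.
move=> w0 t x y _ _.
rewrite -[X in X <= _]/(chain w s (t%:num *: x + (1 - t%:num) *: y)).
rewrite -[X in _ <= X]/(t%:num * chain w s x + (1 - t%:num) * chain w s y).
have p0 : 0 <= t%:num by exact: ge0.
have p1 : t%:num <= 1 by exact: le1.
move: (t%:num) p0 p1 => p p0 p1; rewrite /chain !mulr_sumr -big_split.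
apply: ler_sum => j _ /=.
(* The boundary value is split like the points, so that [link_lin] applies. The convexity defect of
   a link is then its weight times [p * (1 - p) * (u - v) ^+ 2]. *)
have {1}-> : s = p * s + (1 - p) * s by ring.
rewrite link_lin; set u := link s x j; set v := link s y j.
rewrite -subr_ge0 [X in 0 <= X](_ : _ = w j * (p * (1 - p) * (u - v) ^+ 2)); last by ring.
by rewrite mulr_ge0 // mulr_ge0 ?sqr_ge0 // mulr_ge0 // subr_ge0.
Qed.

Lemma is_derive_chain_coord s x v n :
  is_derive x v (fun z => chain_coord s z n) (chain_coord 0 v n).
Proof.
case: n => [|n] /=; first exact: is_derive_cst.
case: insub => [i|]; last exact: is_derive_cst.
apply: DeriveDef; first exact/diff_derivable/differentiable_coord.
have := derive_mx (@derivable_id _ _ x v); rewrite derive_id => /matrixP/(_ 0 i).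
by rewrite mxE => ->.
Qed.

Lemma differentiable_chain_coord s x n :
  differentiable (fun z : 'rV[R]_d => chain_coord s z n) x.
Proof.
case: n => [|n] /=; first exact: differentiable_cst.
case: insub => [i|]; last exact: differentiable_cst.
exact: differentiable_coord.
Qed.

(** In this form, as an expression in functions, the differentiation rules for sums, multiples and
    powers apply. *)
Lemma chain_fctE w s :
  chain w s = \sum_(j < d.+1) w j *:
    ((fun z : 'rV[R]_d => chain_coord s z j) - (fun z => chain_coord s z j.+1)) ^+ 2.
Proof.
by apply/funext => z; rewrite fct_sumE; apply: eq_bigr.
Qed.

Lemma differentiable_chain w s x : differentiable (chain w s) x.
Proof.
rewrite chain_fctE; apply: differentiable_sum => j; apply: differentiableZ.
apply/differentiableX/differentiableB; exact: differentiable_chain_coord.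
Qed.

Lemma derive_chain w s x v :
  'D_v (chain w s) x = \sum_(j < d.+1) w j * (2 * link s x j * link 0 v j).
Proof.
rewrite chain_fctE; apply: derive_val; apply: is_derive_sum => j.
apply: is_deriveZ; apply: is_deriveX.
by apply: is_deriveB; apply: is_derive_chain_coord.
Qed.

(** Entry [m] of the vector sits at position [m.+1], between links [m] and [m.+1], so no other link
    varies with it. *)
Lemma grad_chain w s x (m : 'I_d) :
  grad (chain w s) x 0 m = 2 * (w m.+1 * link s x m.+1 - w m * link s x m).
Proof.
rewrite mxE derive_chain.
pose F n : R := 2 * w n * link s x n.
have delta_coord n : chain_coord 0 (delta_mx 0 m) n = (n == m.+1)%:R :> R.
  case: n => [|n] //=; case: insubP => [i _ <-|]; first by rewrite mxE eqxx eqSS -val_eqE.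
  by rewrite eqSS; case: eqP => // ->; rewrite ltn_ord.
have -> : \sum_(j < d.+1) w j * (2 * link s x j * link 0 (delta_mx 0 m) j)
    = \sum_(j < d.+1) F j * (j == m.+1 :> nat)%:R
      - \sum_(j < d.+1) F j * (j == m :> nat)%:R.
  rewrite -sumrB; apply: eq_bigr => j _.
  by rewrite /F {2}/link !delta_coord eqSS; ring.
have pick n : (n < d.+1)%N -> \sum_(j < d.+1) F j * (j == n :> nat)%:R = F n.
  move=> nd; rewrite (bigD1 (Ordinal nd)) //= eqxx mulr1 big1 ?addr0 // => j.
  by rewrite -val_eqE /= => /negPf ->; rewrite mulr0.
by rewrite !pick ?ltnS ?ltn_ord ?(ltnW (ltn_ord _)) // /F; ring.
Qed.

(** Of two adjacent links at most one carries weight, so the squared gradient difference has no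
    cross terms. *)
Lemma smooth_chain w s a : 0 <= a ->
  (forall j, 0 <= w j <= a) -> (forall j, w j * w j.+1 = 0) ->
  smooth (4 * a) (chain w s : 'rV[R]_d -> R).
Proof.
move=> a0 wa ww; split=> [x|x y]; first exact: differentiable_chain.
set z := x - y; pose l := link 0 z; pose e := chain_coord 0 z.
have grad_sq (m : 'I_d) : (grad (chain w s) x - grad (chain w s) y) 0 m ^+ 2
    = 4 * (w m.+1 ^+ 2 * l m.+1 ^+ 2) + 4 * (w m ^+ 2 * l m ^+ 2).
  rewrite mxE [X in _ + X]mxE !grad_chain.
  have lE n : l n = link s x n - link s y n by rewrite /l -(subrr s) linkB.
  transitivity (4 * (w m.+1 ^+ 2 * l m.+1 ^+ 2) + 4 * (w m ^+ 2 * l m ^+ 2)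
     - 8 * (w m * w m.+1) * l m * l m.+1).
    by rewrite !lE; ring.
  by rewrite ww mulr0 !mul0r subr0.
(* Each link enters at most two gradient coordinates, with factor 4 each time. *)
have le_links : \sum_(m < d) (grad (chain w s) x - grad (chain w s) y) 0 m ^+ 2
    <= 8 * \sum_(j < d.+1) w j ^+ 2 * l j ^+ 2.
  under eq_bigr do rewrite grad_sq.
  rewrite big_split /= -!mulr_sumr.
  have p0 j : 0 <= w j ^+ 2 * l j ^+ 2 by rewrite mulr_ge0 ?sqr_ge0.
  have le1 : \sum_(i < d) w i.+1 ^+ 2 * l i.+1 ^+ 2
      <= \sum_(j < d.+1) w j ^+ 2 * l j ^+ 2 by rewrite big_ord_recl lerDr.
  have le2 : \sum_(i < d) w i ^+ 2 * l i ^+ 2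
      <= \sum_(j < d.+1) w j ^+ 2 * l j ^+ 2 by rewrite big_ord_recr lerDl.
  lra.
(* Here [(u - v) ^+ 2 <= 2 * u ^+ 2 + 2 * v ^+ 2], and the sum is regrouped by positions; both ends
   drop out because [e] vanishes there. *)
have le_coords : \sum_(j < d.+1) w j ^+ 2 * l j ^+ 2
    <= 2 * \sum_(m < d) (w m.+1 ^+ 2 + w m ^+ 2) * z 0 m ^+ 2.
  apply: (@le_trans _ _ (\sum_(j < d.+1)
      (2 * (w j ^+ 2 * e j ^+ 2) + 2 * (w j ^+ 2 * e j.+1 ^+ 2)))).
    apply: ler_sum => j _; rewrite -subr_ge0.
    rewrite [X in 0 <= X](_ : _ = w j ^+ 2 * (e j + e j.+1) ^+ 2).
      by rewrite mulr_ge0 ?sqr_ge0.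
    by rewrite /l /link -/e; ring.
  rewrite big_split /= -!mulr_sumr.
  have -> : \sum_(j < d.+1) w j ^+ 2 * e j ^+ 2 = \sum_(m < d) w m.+1 ^+ 2 * z 0 m ^+ 2.
    rewrite big_ord_recl [e ord0]/= expr0n /= mulr0 add0r.
    by apply: eq_bigr => m _; rewrite -[z 0 m](chain_coordS 0).
  have -> : \sum_(j < d.+1) w j ^+ 2 * e j.+1 ^+ 2 = \sum_(m < d) w m ^+ 2 * z 0 m ^+ 2.
    rewrite big_ord_recr [e _]chain_coord_out // expr0n /= mulr0 addr0.
    by apply: eq_bigr => m _; rewrite -[z 0 m](chain_coordS 0).
  by rewrite -mulrDr -big_split /=; under eq_bigr do rewrite -mulrDl.
(* One of two adjacent weights is zero, so their squares add up to at most [a ^+ 2]. The total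
   factor is [8 * 2 * a ^+ 2 = (4 * a) ^+ 2]. *)
have le_a : \sum_(m < d) (w m.+1 ^+ 2 + w m ^+ 2) * z 0 m ^+ 2
    <= a ^+ 2 * \sum_(m < d) z 0 m ^+ 2.
  rewrite mulr_sumr; apply: ler_sum => m _; rewrite ler_wpM2r ?sqr_ge0 //.
  have /andP[w0 wle] := wa m; have /andP[w'0 w'le] := wa m.+1.
  by have := ww m; nra.
rewrite /enorm -[4 * a]ger0_norm ?mulr_ge0 // -sqrtr_sqr -sqrtrM ?sqr_ge0 //.
by apply: ler_wsqrtr; rewrite exprMn; lra.
Qed.

(** Links beyond [k] vanish at such a point, and link [k] alone joins a seen position to an unseen
    one; a zero weight there stops the gradient. *)
Lemma grad_chain_low w s x k : w k = 0 ->
  (forall i : 'I_d, (k <= i)%N -> x 0 i = 0) ->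
  forall i : 'I_d, (k <= i)%N -> grad (chain w s) x 0 i = 0.
Proof.
move=> wk x0 i ki; rewrite grad_chain.
have coord0 n : (k < n)%N -> chain_coord s x n = 0.
  by move=> kn; apply: chain_coordP => [|m def_n]; [lia|apply: x0; lia].
rewrite {1}/link !coord0 ?subrr ?mulr0 ?sub0r; try lia.
move: ki; rewrite leq_eqVlt => /predU1P[<-|ki]; first by rewrite wk mul0r oppr0 mulr0.
by rewrite /link !coord0 ?subrr ?mulr0 ?oppr0 ?mulr0 //; lia.
Qed.

(** This is Cauchy-Schwarz with its defect kept, since the defect is what identifies the
    minimizer. *)
Lemma sum_sqr_mean n (F : nat -> R) t : \sum_(0 <= j < n.+1) F j = t ->
  \sum_(0 <= j < n.+1) F j ^+ 2 =
  \sum_(0 <= j < n.+1) (F j - t / n.+1%:R) ^+ 2 + t ^+ 2 / n.+1%:R.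
Proof.
move=> sumF; have n0 : n.+1%:R != 0 :> R by rewrite pnatr_eq0.
rewrite (eq_bigr (fun j => (F j - t / n.+1%:R) ^+ 2
    + (2 * (t / n.+1%:R) * F j - (t / n.+1%:R) ^+ 2))) => [|j _]; last by ring.
rewrite big_split /= sumrB -mulr_sumr sumF sumr_const_nat subn0 -mulr_natr.
by congr (_ + _); field.
Qed.

(** Linear interpolation from [s] at position 0 to 0 at position [d.+1], which makes all links
    equal. *)
Definition chain_min s : 'rV[R]_d := \row_(m < d) (s * (1 - m.+1%:R / d.+1%:R)).

Lemma chain_coord_min s n : (n <= d.+1)%N ->
  chain_coord s (chain_min s) n = s * (1 - n%:R / d.+1%:R).
Proof.
have d0 : d.+1%:R != 0 :> R by rewrite pnatr_eq0.
case: n => [|n] nd; first by rewrite /= mul0r subr0 mulr1.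
move: nd; rewrite leq_eqVlt => /predU1P[[->]|nd].
  by rewrite chain_coord_out // divff // subrr mulr0.
by rewrite (chain_coordS s _ (Ordinal (nd : (n < d)%N))) mxE.
Qed.

Lemma link_min s n : (n <= d)%N -> link s (chain_min s) n = s / d.+1%:R.
Proof.
move=> nd; rewrite /link (chain_coord_min s (leqW nd)) (@chain_coord_min s n.+1) //.
rewrite -[n.+1%:R]natr1.
have d0 : d.+1%:R != 0 :> R by rewrite pnatr_eq0.
by field.
Qed.

(** The links sum to [s] for every [x], so only their deviation from the mean depends on [x]. *)
Lemma chain_const c s x : chain (fun=> c) s x =
  c * (\sum_(0 <= j < d.+1) (link s x j - s / d.+1%:R) ^+ 2 + s ^+ 2 / d.+1%:R).
Proof.
rewrite /chain -mulr_sumr -(big_mkord xpredT (fun j => link s x j ^+ 2)).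
have sum_s : \sum_(0 <= j < d.+1) link s x j = s.
  by rewrite sum_link chain_coord_out ?subr0.
by rewrite (sum_sqr_mean sum_s).
Qed.

Lemma chain_min_val c s : chain (fun=> c) s (chain_min s) = c * (s ^+ 2 / d.+1%:R).
Proof.
rewrite chain_const big_nat big1 ?add0r // => j /andP[_ jd].
by rewrite link_min // subrr expr0n.
Qed.

Lemma chain_minimizer c s : 0 < c -> is_minimizer (chain (fun=> c) s) (chain_min s) /\
  forall y, is_minimizer (chain (fun=> c) s) y -> y = chain_min s.
Proof.
move=> c0; split=> [y|y /(_ (chain_min s))].
  rewrite chain_min_val chain_const ler_pM2l // lerDr.
  by apply: sumr_ge0 => j _; apply: sqr_ge0.
rewrite chain_min_val chain_const ler_pM2l // gerDr => sum_le0.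
have link_y j : (j <= d)%N -> link s y j = s / d.+1%:R.
  move=> jd; apply/eqP; rewrite -subr_eq0 -sqrf_eq0; apply/eqP.
  have /eqP : \sum_(0 <= j < d.+1) (link s y j - s / d.+1%:R) ^+ 2 = 0.
    by apply/eqP; rewrite eq_le sum_le0 sumr_ge0 // => i _; apply: sqr_ge0.
  rewrite psumr_eq0 => [/allP/(_ j)|i _]; last exact: sqr_ge0.
  by rewrite mem_index_iota /= ltnS jd => /(_ isT)/eqP.
apply/rowP => m; rewrite -!(chain_coordS s).
(* The links determine the point, so equality of all links yields uniqueness. *)
have coordE x : chain_coord s x m.+1 = s - \sum_(0 <= j < m.+1) link s x j.
  by rewrite sum_link; ring.
rewrite !coordE; congr (_ - _); apply: eq_big_nat => j /andP[_ jm].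
by have := ltn_ord m => md; rewrite link_min ?link_y //; lia.
Qed.

(** Position [k.+1] already holds 0, so the first [k.+1] links sum to [s]; the other links are
    dropped. *)
Lemma chain_low_bound c s x k : 0 <= c -> (k <= d)%N ->
  (forall i : 'I_d, (k <= i)%N -> x 0 i = 0) ->
  c * (s ^+ 2 / k.+1%:R) <= chain (fun=> c) s x.
Proof.
move=> c0 kd x0; rewrite /chain -mulr_sumr ler_wpM2l //.
rewrite -(big_mkord xpredT (fun j => link s x j ^+ 2)).
rewrite (big_cat_nat _ (n := k.+1)) //=.
have sum_s : \sum_(0 <= j < k.+1) link s x j = s.
  by rewrite sum_link chain_coordP ?subr0 // => i [ki]; rewrite x0 // ki.
rewrite (sum_sqr_mean sum_s) -addrA addrCA lerDl.
by apply: addr_ge0; apply: sumr_ge0 => j _; apply: sqr_ge0.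
Qed.

Lemma enorm_chain_min s : 0 <= s -> enorm (chain_min s) <= s * Num.sqrt d%:R.
Proof.
move=> s0; rewrite /enorm -[s in X in _ <= X]ger0_norm // -sqrtr_sqr -sqrtrM ?sqr_ge0 //.
apply: ler_wsqrtr; apply: (@le_trans _ _ (\sum_(j < d) s ^+ 2)).
  apply: ler_sum => j _; rewrite mxE ler_sqr ?nnegrE //.
    rewrite ler_piMr // gerBl divr_ge0 //.
  rewrite mulr_ge0 // subr_ge0 ler_pdivrMr // mul1r ler_nat ltnS.
  exact: ltnW.
by rewrite sumr_const card_ord mulr_natr.
Qed.

End Chain.

(** * Discovery of coordinates *)

Definition low (R : realType) (d k : nat) (v : 'rV[R]_d) : Prop :=
  forall i : 'I_d, (k <= i)%N -> v 0 i = 0.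

Lemma low_lin (R : realType) (d k : nat) (a : R) (u v : 'rV[R]_d) :
  low k u -> low k v -> low k (a *: u + v).
Proof. by move=> u0 v0 i ki; rewrite !mxE u0 // v0 // mulr0 addr0. Qed.

Lemma low_sum (R : realType) (d k : nat) (I : finType) (P : pred I) (F : I -> 'rV[R]_d) :
  (forall i, P i -> low k (F i)) -> low k (\sum_(i | P i) F i).
Proof. by move=> F0 j kj; rewrite summxE big1 // => i Pi; apply: F0. Qed.

Lemma lowW (R : realType) (d k k' : nat) (v : 'rV[R]_d) :
  (k <= k')%N -> low k v -> low k' v.
Proof. by move=> kk' v0 i k'i; apply/v0/(leq_trans kk'). Qed.

(** Adaptive queries gain nothing: the subspace is closed under the oracle, hence under any number
    of calls. *)
Lemma local_span_low (R : realType) (d k : nat) (g : 'rV[R]_d -> 'rV[R]_d)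
    (W : {vspace 'rV[R]_d}) :
  (forall v, v \in W -> low k v) -> (forall v, low k v -> low k (g v)) ->
  forall v, local_span g W v -> low k v.
Proof.
move=> W0 g0 v; elim=> {v} [v /W0 //|a u v _ u0 _ v0|y _ y0]; last exact: g0.
exact: low_lin.
Qed.

(** [g] is the number of owners at each end of the path; the theorem takes [M %/ 3]. *)
Definition owns (M g i j : nat) : bool := if odd j then (M - g <= i)%N else (i < g)%N.

(** Hops from node [i] to the nearest owner of link [k], for [0 < g]; truncated subtraction makes it
    0 at the owners. *)
Definition owner_dist (M g i k : nat) : nat :=
  (if odd k then M - g - i else i.+1 - g)%N.

(* Coordinate [k] can only be discovered by an owner of link [k], and the owners
   of links [k] and [k - 1] are [M - 2g + 1] hops apart. *)
Lemma run_low (R : realType) (d M g S : nat) (a s : R)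
    (A : nat -> 'I_M -> {vspace 'rV[R]_d}) (out : 'I_M -> 'rV[R]_d) :
  (0 < g)%N -> (g * 2 <= M)%N ->
  linear_span_run (@path_edge M)
    (fun i => chain (fun j => a * (owns M g i j)%:R) s) S A out ->
  forall t k (i : 'I_M), (t <= S)%N ->
    (t <= k * (M - g * 2).+1 + owner_dist M g i k)%N ->
  forall v, v \in A t i -> low k v.
Proof.
move=> g0 gM [A0 AS _]; elim=> [|t IHt] k i tS tk v vA.
  by move: vA; rewrite A0 memv0 => /eqP-> j _; rewrite mxE.
pose W := (A t i + \sum_(j | path_edge i j) A t j)%VS.
have W_low l : (t <= l * (M - g * 2).+1 + owner_dist M g i l)%N ->
    (forall j, path_edge i j -> (t <= l * (M - g * 2).+1 + owner_dist M g j l)%N) ->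
    forall u, u \in W -> low l u.
  move=> ti tj u /memv_addP[x xA [y /memv_sumP[z zA ->] ->]].
  rewrite -[x]scale1r; apply: low_lin; first by apply: IHt xA; lia.
  by apply: low_sum => j ij; apply: IHt (zA j ij); [lia|exact: tj].
have vW := AS t i v tS vA.
have grad_low l : ~~ owns M g i l -> forall u : 'rV[R]_d, low l u ->
    low l (grad (chain (fun j => a * (owns M g i j)%:R) s) u).
  by move=> /negPf il u ul; apply: grad_chain_low => //; rewrite il mulr0.
(* A node that does not own link [k] only relays. One hop changes the distance by at most one, which
   the extra round pays for. *)
have [ik|ik] := boolP (owns M g i k); last first.
  apply: local_span_low vW; last exact: grad_low.
  have d0 : (0 < owner_dist M g i k)%N by move: ik; rewrite /owns /owner_dist; case: odd; lia.
  apply: W_low; first lia.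
  by move=> j; rewrite /path_edge; move: tk d0; rewrite /owner_dist; case: odd; lia.
have d0 : owner_dist M g i k = 0%N by move: ik; rewrite /owns /owner_dist; case: odd; lia.
(* For an owner the time bound at [k = 0] reads [t.+1 <= 0], which is absurd. Otherwise the owner of
   link [k.+1] does not own link [k] and is so far from its owners that even support in the first
   [k] coordinates holds. *)
case: k tk ik d0 => [|k] tk ik d0; first by move: tk; rewrite mul0n d0.
apply: (lowW (leqnSn k)).
have iM := ltn_ord i.
have ik' : ~~ owns M g i k.
  by move: ik; rewrite /owns /=; case: odd => /=; lia.
have di : ((M - g * 2).+1 <= owner_dist M g i k)%N.
  by move: ik; rewrite /owns /owner_dist /=; case: odd => /=; lia.
apply: local_span_low vW; last exact: grad_low.
rewrite d0 addn0 mulSn in tk; apply: W_low; first lia.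
move=> j; rewrite /path_edge; move: di tk; rewrite /owner_dist; case: odd; lia.
Qed.

Lemma owns_disjoint (M g j : nat) (i : 'I_M) : (g * 2 <= M)%N ->
  owns M g i j && owns M g i j.+1 = false.
Proof. by move=> gM; rewrite /owns /=; case: odd => /=; lia. Qed.

(** Links of both parities have equally many owners, which gives the average constant weights. *)
Lemma sum_owns (R : realType) (M g j : nat) : (g <= M)%N ->
  \sum_(i < M) (owns M g i j)%:R = g%:R :> R.
Proof.
move=> gM; rewrite -(big_mkord xpredT (fun i => (owns M g i j)%:R)) /owns.
case: (odd j).
  rewrite (big_cat_nat _ (n := (M - g)%N)) ?leq_subr //= big_nat big1 => [|i /andP[_ ig]].
    rewrite add0r big_nat (eq_bigr (fun=> 1)) => [|i /andP[-> _]] //.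
    by rewrite -big_nat sumr_const_nat subKn.
  by rewrite leqNgt ig.
rewrite (big_cat_nat _ (n := g)) //= addrC big_nat big1 => [|i /andP[gi _]].
  rewrite add0r big_nat (eq_bigr (fun=> 1)) => [|i /andP[_ ->]] //.
  by rewrite -big_nat sumr_const_nat subn0.
by rewrite ltnNge gi.
Qed.

Lemma average_chain (R : realType) (d M g : nat) (a s : R) : (g <= M)%N ->
  average (fun i : 'I_M => chain (fun j => a * (owns M g i j)%:R) s) =
  chain (fun=> M%:R^-1 * (g%:R * a)) s :> ('rV[R]_d -> R).
Proof.
move=> gM; apply/funext => x; rewrite /average /chain exchange_big mulr_sumr.
apply: eq_bigr => j _; rewrite -mulr_suml -mulr_sumr sum_owns //.
by ring.
Qed.

(** * Numerical bounds and the final estimate *)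

Lemma pi_le4 (R : realType) : pi <= 4 :> R.
Proof. by have [/andP[_ pi2] _] := pihalf_02_cos_pihalf R; move: pi2; lra. Qed.

(** With [2 <= pi <= 4], the factors [1/16] and [1/4] of [half_versine_bounds] become [1/4] and
    [4]. *)
Lemma path_rho_bounds (R : realType) (M : nat) : (3 <= M)%N ->
  4^-1 / M%:R ^+ 2 <= 2^-1 * (1 - cos (pi / M%:R : R)) <= 4 / M%:R ^+ 2.
Proof.
move=> M3; have M0 : (0 : R) < M%:R by rewrite ltr0n; lia.
have x0 : 0 < pi / M%:R :> R by rewrite divr_gt0 ?pi_gt0.
have x3 : pi / M%:R <= pi / 3 :> R.
  by rewrite ler_pM2l ?pi_gt0 // lef_pV2 ?posrE // ler_nat.
have /andP[ge_rho le_rho] := half_versine_bounds x0 x3.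
have pi2 := pi_ge2 R; have pi4 := pi_le4 R.
apply/andP; split; [apply: le_trans ge_rho|apply: (le_trans le_rho)];
  rewrite expr_div_n mulrAC ler_pM2r ?invr_gt0 ?exprn_gt0 //; nra.
Qed.

(** For [p = S * sqrt rho], the value [6 * p + 2] will bound [k + 1]. It is at most 8 if [p <= 1]
    and at most [8 * p] otherwise, whence 64. *)
Lemma min_inv_sqr_le (R : realType) (p : R) : 0 < p ->
  Num.min 1 (p ^+ 2)^-1 <= 64 / (6 * p + 2) ^+ 2.
Proof.
move=> p0; have q0 : 0 < (6 * p + 2) ^+ 2 by rewrite exprn_gt0 //; lra.
have [p1|p1] := leP p 1.
  by rewrite ge_min ler_pdivlMr // mul1r (_ : (6 * p + 2) ^+ 2 <= 64) //; nra.
rewrite ge_min; apply/orP; right.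
by rewrite ler_pdivlMr // ler_pdivrMl ?exprn_gt0 //; nra.
Qed.

Theorem theorem2 (R : realType) :
  exists c a1 a2 b1 b2 : R,
    [/\ 0 < c, 0 < a1, 0 < a2, 0 < b1 & 0 < b2] /\
    forall M : nat, (6 <= M)%N ->
    let rho := spectral_gap (path_gossip R M) in
    [/\ rho = 2^-1 * (1 - cos (pi / M%:R)),
        b1 / M%:R ^+ 2 <= rho <= b2 / M%:R ^+ 2
      & forall (L r : R) (S : nat), 0 < L -> 0 < r -> (1 <= S)%N ->
        exists (d : nat) (f : 'I_M -> 'rV[R]_d -> R) (xstar : 'rV[R]_d),
        [/\ a1 * (1 + S%:R * Num.sqrt rho) <= d%:R
              <= a2 * (1 + S%:R * Num.sqrt rho),
            forall i, convex_function [set: 'rV[R]_d] (f i) /\ smooth L (f i),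
            is_minimizer (average f) xstar /\
              (forall y, is_minimizer (average f) y -> y = xstar),
            enorm xstar <= r
          & forall (A : nat -> 'I_M -> {vspace 'rV[R]_d})
                   (out : 'I_M -> 'rV[R]_d),
            linear_span_run (@path_edge M) f S A out ->
            c * L * r ^+ 2 * Num.min 1 (rho * S%:R ^+ 2)^-1
              <= average f (M%:R^-1 *: \sum_(i < M) out i)
                 - average f xstar]].
Proof.
(* One factor 64 comes from [min_inv_sqr_le]; the other is [16 * 4], from [cf >= L / 16] and
   [2 * d * K <= 4 * K ^+ 2]. The values 1 and 12 come from [p <= 2 * k] and
   [2 * k + 1 <= 12 * p + 3]. *)
exists (64 * 64)^-1, 1, 12, (4^-1), 4; split; first by split; lra.
move=> M M6 rho.
have rhoE : rho = 2^-1 * (1 - cos (pi / M%:R)) by apply: spectral_gap_path; lia.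
have rho_bd : 4^-1 / M%:R ^+ 2 <= rho <= 4 / M%:R ^+ 2.
  by rewrite rhoE; apply: path_rho_bounds; lia.
clearbody rho; split=> // L r S L0 r0 S1.
have M0 : (0 : R) < M%:R by rewrite ltr0n; lia.
have S0 : (0 : R) < S%:R by rewrite ltr0n.
(* [D] is the hop distance between the owners of consecutive links, and [k] is the least integer
   with [S < k * D]. *)
pose g := (M %/ 3)%N; pose D := (M - g * 2).+1; pose k := (S %/ D).+1.
have gM : (g * 2 <= M)%N by rewrite /g; lia.
have gM1 : (g <= M)%N by rewrite /g; lia.
have g0 : (0 < g)%N by rewrite /g; lia.
(* This uses [6 <= M]: it fails for [M = 5]. *)
have g4 : (M <= g * 4)%N by rewrite /g; lia.
have D3 : (M <= D * 3)%N by rewrite /D /g; lia.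
have DM : (D <= M)%N by rewrite /D /g; lia.
have Sk : (S < k * D)%N by rewrite /k; apply: ltn_ceil.
have kS : (k.-1 * D <= S)%N by rewrite /k /=; apply: leq_trunc_div.
have k_gt0 : (0 < k)%N by [].
clearbody k; clearbody g.
pose T : R := S%:R / M%:R; pose p := S%:R * Num.sqrt rho.
have T0 : 0 < T by rewrite divr_gt0.
have Tk : T <= k%:R.
  rewrite ler_pdivrMr // -natrM ler_nat; apply: leq_trans (ltnW Sk) _.
  by rewrite leq_mul2l DM orbT.
have kT : k%:R <= 3 * T + 1.
  rewrite -lerBlDr /T mulrA ler_pdivlMr // -[k]prednK // -natr1 addrK.
  rewrite -!natrM ler_nat (leq_trans (leq_mul (leqnn _) D3)) //.
  by rewrite mulnA mulnC leq_mul2l kS.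
have M2 : (0 : R) < M%:R ^+ 2 by rewrite exprn_gt0.
have /andP[rho_ge rho_le] := rho_bd.
have rho0 : 0 < rho by apply: lt_le_trans rho_ge; rewrite divr_gt0 ?invr_gt0.
have p0 : 0 < p by rewrite mulr_gt0 ?sqrtr_gt0.
have p2 : p ^+ 2 = rho * S%:R ^+ 2 by rewrite exprMn sqr_sqrtr ?ltW // mulrC.
have p_ge : T / 2 <= p.
  rewrite -ler_sqr ?nnegrE ?divr_ge0 ?(ltW T0) ?(ltW p0) // p2.
  rewrite (_ : (T / 2) ^+ 2 = 4^-1 / M%:R ^+ 2 * S%:R ^+ 2).
    by rewrite ler_wpM2r ?sqr_ge0.
  by rewrite /T; field; rewrite gt_eqF.
have p_le : p <= 2 * T.
  rewrite -ler_sqr ?nnegrE ?mulr_ge0 ?(ltW T0) ?(ltW p0) // p2.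
  rewrite (_ : (2 * T) ^+ 2 = 4 / M%:R ^+ 2 * S%:R ^+ 2).
    by rewrite ler_wpM2r ?sqr_ge0.
  by rewrite /T; field; rewrite gt_eqF.
have pE : S%:R * Num.sqrt rho = p by [].
clearbody T p.
have min_le : Num.min 1 (rho * S%:R ^+ 2)^-1 <= 64 / (k%:R + 1) ^+ 2.
  rewrite -p2; apply: le_trans (min_inv_sqr_le p0) _.
  have k0 : 0 <= k%:R :> R by rewrite ler0n.
  rewrite ler_pM2l // lef_pV2 ?posrE ?exprn_gt0 // ?ler_sqr ?nnegrE; lra.
(* This [d] makes the minimum exactly half of the lower bound on revealed points, as
   [d + 1 = 2 * (k + 1)]; [s] keeps the norm of the minimizer within [r], and [a] makes the
   smoothness constant [4 * a] equal to [L]. *)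
pose d := (2 * k).+1; pose s := r / Num.sqrt d%:R; pose a := L / 4.
have d0 : (0 : R) < d%:R by rewrite ltr0n.
have s0 : 0 < s by rewrite divr_gt0 ?sqrtr_gt0.
have dE : d%:R = 2 * k%:R + 1 :> R by rewrite /d -natr1 natrM.
pose f (i : 'I_M) : 'rV[R]_d -> R := chain (fun j => a * (owns M g i j)%:R) s.
have fE : average f = chain (fun=> M%:R^-1 * (g%:R * a)) s by exact: average_chain.
set cf := M%:R^-1 * (g%:R * a) in fE.
have a0 : 0 < a by rewrite divr_gt0.
have cf0 : 0 < cf by rewrite mulr_gt0 ?invr_gt0 // mulr_gt0 // ltr0n.
exists d, f, (chain_min d s); split.
- by rewrite dE pE; apply/andP; split; lra.
- move=> i; split.
    by apply: convex_chain => j; rewrite mulr_ge0 ?ler0n ?ltW.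
  rewrite (_ : L = 4 * a); last by rewrite /a; field.
  apply: smooth_chain => [|j|j]; first exact: ltW.
    by case: (owns _ _ _ _); rewrite ?mulr1 ?mulr0 ?lexx ltW.
  by rewrite mulrACA -natrM mulnb owns_disjoint ?mulr0.
- by rewrite fE; apply: chain_minimizer.
- apply: le_trans (enorm_chain_min _ (ltW s0)) _.
  by rewrite /s divfK // gt_eqF // sqrtr_gt0.
move=> A out run; set xbar := _ *: _.
have xbar_low : low k xbar.
  rewrite /xbar -[X in low k X]addr0; apply: low_lin => [|i _]; last by rewrite mxE.
  apply: low_sum => i _; have [_ _ outA] := run.
  (* Since [S <= k * D], the time bound holds at every node, whatever its distance to an owner. *)
  apply: (run_low g0 gM run (leqnn S) _ (outA i)).
  exact: leq_trans (ltnW Sk) (leq_addr _ _).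
rewrite fE chain_min_val.
have kd : (k <= d)%N by rewrite /d ltnW // ltnS leq_pmull.
apply: le_trans (lerB (chain_low_bound s (ltW cf0) kd xbar_low) (lexx _)).
have k0 : 0 <= k%:R :> R by rewrite ler0n.
have -> : d.+1%:R = 2 * k.+1%:R :> R by rewrite -[d.+1%:R]natr1 -[k.+1%:R]natr1 dE; ring.
have -> : s ^+ 2 = r ^+ 2 / d%:R by rewrite expr_div_n sqr_sqrtr ?ltW.
have cf_ge : L / 16 <= cf.
  rewrite /cf /a ler_pdivlMl //.
  have : (M%:R : R) <= g%:R * 4 by rewrite -natrM ler_nat.
  nra.
apply: (@le_trans _ _ ((64 * 64)^-1 * L * r ^+ 2 * (64 / (k%:R + 1) ^+ 2))).
  apply: ler_wpM2l min_le; apply: mulr_ge0 (sqr_ge0 _).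
  by apply: mulr_ge0 (ltW L0); rewrite invr_ge0 mulr_ge0 ?ler0n.
rewrite -[k.+1%:R]natr1; set K := k%:R + 1; have K0 : 0 < K by rewrite /K; lra.
apply: (@le_trans _ _ (L / 16 * (r ^+ 2 / (4 * K ^+ 2)))).
  by rewrite le_eqVlt; apply/orP; left; apply/eqP; field; rewrite gt_eqF.
have -> : cf * (r ^+ 2 / d%:R / K) - cf * (r ^+ 2 / d%:R / (2 * K))
    = cf * (r ^+ 2 / (2 * d%:R * K)) by field; rewrite !gt_eqF.
apply: ler_pM => //; first by rewrite divr_ge0 ?ltW.
  by rewrite divr_ge0 ?sqr_ge0 // mulr_ge0 ?sqr_ge0.
(* What remains is [2 * d * K <= 4 * K ^+ 2], true because [d = 2 * k + 1 <= 2 * K]. *)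
rewrite ler_wpM2l ?sqr_ge0 // lef_pV2 ?posrE ?mulr_gt0 ?exprn_gt0 //.
by rewrite dE /K; nra.
Qed.
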